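(* Let $M\subset K$ be number fields, and let $\mathcal{O}$ be either the ring of integers $\mathbb{Z}_K$ of $K$ or an order in $\mathbb{Z}_K$, such that $\mathcal{O}$ has a relative integral basis over $M$. A primitive element $\alpha\in\mathcal{O}$ generates a power integral basis of $\mathcal{O}$ if and only if $$I_{\mathcal{O}/M}(\alpha)=1 \quad\text{and}\quad J(\alpha)=(\mathbb{Z}_M[\alpha]^+:\mathbb{Z}[\alpha]^+)=1 .$$
   Context: $\mathbb{Z}_K$ and $\mathbb{Z}_M$ denote the rings of integers of $K$ and $M$. A relative integral basis of $\mathcal{O}$ over $M$ is a basis of $\mathcal{O}$ as a free $\mathbb{Z}_M$-module (so in particular $\mathbb{Z}_M\subseteq\mathcal{O}$). An element $\alpha\in\mathcal{O}$ is primitive if $K=\mathbb{Q}(\alpha)$. It generates a power integral basis of $\mathcal{O}$ if $\mathcal{O}=\mathbb{Z}[\alpha]$, i.e. $\{1,\alpha,\ldots,\alpha^{n-1}\}$ with $n=[K:\mathbb{Q}]$ is a $\mathbb{Z}$-basis of $\mathcal{O}$. For a ring $R$, $R^+$ denotes its additive group, and $(G:H)$ denotes the index of a subgroup $H$ in a group $G$. The relative index of $\alpha$ is $I_{\mathcal{O}/M}(\alpha)=(\mathcal{O}^+:\mathbb{Z}_M[\alpha]^+)$, and $J(\alpha)=(\mathbb{Z}_M[\alpha]^+:\mathbb{Z}[\alpha]^+)$. *)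

(* Defs.v *)
From mathcomp Require Import all_boot all_order all_algebra all_field.
From mathcomp Require Import finmap boolp classical_sets functions cardinality.

Set Implicit Arguments.
Unset Strict Implicit.
Unset Printing Implicit Defensive.

Import GRing.Theory.

Local Open Scope classical_set_scope.
Local Open Scope ring_scope.

Section NumberField.

(* A number field is a finite extension of rat; its subfields are the terms
   of type {subfield K}, the whole of K being {:K}. *)
Variable K : fieldExtType rat.

Definition rational_integers : set K := range (intr : int -> K).

Definition ring_of_integers (M : {subfield K}) : set K :=
  [set x | x \in M /\ integralOver (intr : int -> K) x].

(* (w_i)_(i < m) is a basis of A as a free R-module, for a subring R of K *)
Definition is_basis (R A : set K) (m : nat) (w : 'I_m -> K) : Prop :=
  A = [set \sum_(i < m) c i * w i | c in [set c : 'I_m -> K | forall i, R (c i)]]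
  /\ (forall c : 'I_m -> K, (forall i, R (c i)) ->
        \sum_(i < m) c i * w i = 0 -> forall i, c i = 0).

Definition is_order (O : set K) : Prop :=
  [/\ O `<=` ring_of_integers {:K},
      subring_closed (mem O)
    & exists w : 'I_(\dim {:K}) -> K, is_basis rational_integers O w].

Definition has_relative_integral_basis (O : set K) (M : {subfield K}) : Prop :=
  exists (m : nat) (w : 'I_m -> K), is_basis (ring_of_integers M) O w.

Definition primitive (alpha : K) : Prop := (<<1; alpha>> = {:K})%VS.

(* The ring R[alpha], for a subring R of K *)
Definition adjoin (R : set K) (alpha : K) : set K :=
  [set p.[alpha] | p in [set p : {poly K} | forall i, R p`_i]].

(* Both descriptions of a power integral basis are kept; they are equivalent
   when alpha is integral and primitive. *)
Definition generates_power_integral_basis (O : set K) (alpha : K) : Prop :=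
  O = adjoin rational_integers alpha
  /\ is_basis rational_integers O (fun i : 'I_(\dim {:K}) => alpha ^+ i).

Definition cosets (G H : set K) : set (set K) :=
  [set [set g + h | h in H] | g in G].

(* The index (G : H) of additive groups, with value 0 if it is infinite *)
Definition additive_index (G H : set K) : nat := #|` fset_set (cosets G H)|.

Definition relative_index (O : set K) (M : {subfield K}) (alpha : K) : nat :=
  additive_index O (adjoin (ring_of_integers M) alpha).

Definition J (M : {subfield K}) (alpha : K) : nat :=
  additive_index (adjoin (ring_of_integers M) alpha) (adjoin rational_integers alpha).

End NumberField.

(* Main.v *)
Require Import Defs.
From mathcomp Require Import all_boot all_order all_algebra all_field.
From mathcomp Require Import finmap boolp classical_sets functions cardinality.

Set Implicit Arguments.
Unset Strict Implicit.
Unset Printing Implicit Defensive.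

Import GRing.Theory Num.Theory.

Local Open Scope classical_set_scope.
Local Open Scope ring_scope.

(** Adjoining [alpha] to the inclusion of [Z] in the integers of [M] gives the
    tower [Z[alpha] <= Z_M[alpha] <= O].  An index of additive groups is 1
    exactly when the two groups coincide ([additive_index1P]), so the two index
    conditions together say that both inclusions are equalities, and this is
    the same as [O = Z[alpha]].

    The upper inclusion is where the relative integral basis matters: it makes
    [O] stable under multiplication by the integers of [M], and since [O]
    contains 1 it contains these integers ([ring_of_integers_sub_basis]).

    There remains to see that [O = Z[alpha]] makes [1, alpha, ...,
    alpha^(n-1)] a basis over [Z], with [n] the degree of [K]
    ([adjoin_rational_integers_basis]).  By Gauss's lemma the minimal polynomial
    of the algebraic integer [alpha] is monic with integer coefficients
    ([minPoly_int]), and it has degree [n] because [alpha] is primitive. *)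

(** * Indices of additive groups *)

(** The coset of 0 is [H] itself, so when there is only one coset every
    [g = g + 0] lies in [H].  In the other direction all translates of [H] by
    its own elements are [H]. *)
Lemma additive_index1P (K : fieldExtType rat) (G H : set K) :
  zmod_closed (mem H) -> H `<=` G -> additive_index G H = 1%N <-> G = H.
Proof.
move=> [H0 HB] HG; rewrite /additive_index; split=> [/eqP/cardfs1P[C cC]|->].
  have fin : finite_set (cosets G H).
    (* [fset_set] sends an infinite set to the empty one, of cardinal 0, not 1 *)
    apply: contrapT => inf; move: cC; rewrite /fset_set; case: pselect => // _.
    by move/fsetP/(_ C); rewrite !inE eqxx.
  have cosetE g : G g -> [set g + h | h in H] = C.
    move=> Gg; suff : cosets G H [set g + h | h in H].
      by rewrite -(fset_setK fin) cC /= inE => /eqP.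
    by exists g.
  have EH : C = H.
    rewrite -(cosetE 0); last exact/HG/set_mem.
    by rewrite -[RHS]image_id; apply: eq_imagel => h _; rewrite add0r.
  apply/seteqP; split=> // g Gg; rewrite -EH -(cosetE g Gg).
  by exists 0; [exact: set_mem | rewrite addr0].
suff -> : cosets H H = [set H] by rewrite fset_set1 cardfs1.
have HN h : H h -> - h \in mem H.
  by move=> /mem_set Hh; rewrite -sub0r; apply: HB.
have cosetH g : H g -> [set g + h | h in H] = H.
  move=> Hg; apply/seteqP; split=> [_ [h Hh <-]|x Hx]; last first.
    exists (x - g); last by rewrite addrC subrK.
    by apply/set_mem/HB; apply: mem_set.
  apply: set_mem; rewrite -[h]opprK; apply: HB; first exact: mem_set.
  exact: HN.
apply/seteqP; split=> [_ [g Hg <-]|_ ->]; first exact: cosetH.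
by exists 0; [exact: set_mem | exact/cosetH/set_mem].
Qed.

(** * Adjoining an element to a subring *)

Lemma sum_subring (K : fieldExtType rat) (A : set K) (m : nat) (F : 'I_m -> K) :
  subring_closed (mem A) -> (forall i, A (F i)) -> A (\sum_(i < m) F i).
Proof.
move=> [A1 AB _] AF.
have A0 : A 0 by have := AB _ _ A1 A1; rewrite subrr => /set_mem.
apply: big_ind => // x y /mem_set Ax /mem_set Ay; apply: set_mem.
have A0y : - y \in mem A by rewrite -sub0r; apply: AB => //; apply: mem_set.
by rewrite -[y]opprK; apply: AB.
Qed.

Lemma adjoin_zmod_closed (K : fieldExtType rat) (R : set K) (alpha : K) :
  zmod_closed (mem R) -> zmod_closed (mem (adjoin R alpha)).
Proof.
move=> [R0 RB]; split=> [|_ _ /set_mem[p Rp <-] /set_mem[q Rq <-]]; apply: mem_set.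
  by exists 0; [move=> i; rewrite coef0; exact: set_mem | rewrite horner0].
exists (p - q); last by rewrite hornerD hornerN.
by move=> i; rewrite coefB; apply/set_mem/RB; apply: mem_set.
Qed.

Lemma adjoinS (K : fieldExtType rat) (R S : set K) (alpha : K) :
  R `<=` S -> adjoin R alpha `<=` adjoin S alpha.
Proof. by move=> RS _ [p Rp <-]; exists p => // i; exact: RS. Qed.

Lemma adjoin_min (K : fieldExtType rat) (R A : set K) (alpha : K) :
  subring_closed (mem A) -> R `<=` A -> A alpha -> adjoin R alpha `<=` A.
Proof.
move=> Aring RA Aalpha _ [p Rp <-]; rewrite horner_coef.
apply: sum_subring => // i; case: Aring => A1 _ AM; apply: set_mem.
apply: (AM); first exact/mem_set/RA.
by elim: (i : nat) => [|k IHk]; rewrite ?expr0 ?exprS //; apply/AM/IHk/mem_set.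
Qed.

(** * The integers of a subfield *)

Lemma rational_integers_zmod_closed (K : fieldExtType rat) :
  zmod_closed (mem (@rational_integers K)).
Proof.
split=> [|_ _ /set_mem[m _ <-] /set_mem[n _ <-]]; apply: mem_set.
  by exists 0; rewrite ?mulr0z.
by exists (m - n) => //; rewrite rmorphB.
Qed.

Lemma ring_of_integers_subring_closed (K : fieldExtType rat) (M : {subfield K}) :
  subring_closed (mem (ring_of_integers M)).
Proof.
split=> [|x y /set_mem[Mx Ix] /set_mem[My Iy]|x y /set_mem[Mx Ix] /set_mem[My Iy]].
- by apply: mem_set; split; [exact: mem1v | exact: integral1].
- by apply: mem_set; split; [exact: rpredB | exact: integral_sub].
- by apply: mem_set; split; [exact: rpredM | exact: integral_mul].
Qed.

Lemma rational_integers_sub (K : fieldExtType rat) (M : {subfield K}) :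
  @rational_integers K `<=` ring_of_integers M.
Proof.
by move=> _ [n _ <-]; split; [rewrite rpred_int | exact: integral_id].
Qed.

(** If [1 = \sum_i c_i w_i] over the relative basis [w], then an integer [z] of
    [M] has coordinates [z c_i], which are again integers of [M]. *)
Lemma ring_of_integers_sub_basis (K : fieldExtType rat) (M : {subfield K}) (A : set K) :
  has_relative_integral_basis A M -> A 1 -> ring_of_integers M `<=` A.
Proof.
move=> [m [w [-> _]]] [c Rc c1] z Rz.
have [_ _ RM] := ring_of_integers_subring_closed M.
exists (fun i => z * c i) => [i|]; first by apply/set_mem/RM; apply: mem_set.
by rewrite -[RHS]mulr1 -c1 mulr_sumr; apply: eq_bigr => i _; rewrite mulrA.
Qed.

(** * Integral power bases *)

Lemma map_poly_int_alg (K : fieldExtType rat) (p : {poly int}) :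
  map_poly (in_alg K) (map_poly intr p) = map_poly intr p.
Proof. by rewrite -map_poly_comp; apply: eq_map_poly => n; exact: (rmorph_int (in_alg K)). Qed.

(** Gauss's lemma: the minimal polynomial is a rational multiple of a primitive
    integer polynomial, which divides the given monic polynomial over [int].
    Its leading coefficient is therefore a positive unit of [int], and two
    proportional monic polynomials are equal. *)
Lemma minPoly_int (K : fieldExtType rat) (alpha : K) :
  integralOver (intr : int -> K) alpha ->
  exists2 p : {poly int}, p \is monic & map_poly intr p = minPoly 1 alpha.
Proof.
case=> q mon_q root_q.
have /polyOver1P[p0 Ep0] := minPolyOver 1 alpha.
have p0_neq0 : p0 != 0.
  by rewrite -(map_poly_eq0 (in_alg K)) -Ep0 monic_neq0 ?monic_minPoly.
have [p [a a_neq0 Ep]] := rat_poly_scale p0.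
have p_neq0 : p != 0.
  by apply: contraNneq p0_neq0; rewrite Ep => ->; rewrite rmorph0 scaler0.
have p0_dvd_q : p0 %| map_poly intr q.
  rewrite -(dvdp_map (in_alg K)) -Ep0 map_poly_int_alg minPoly_dvdp //.
  by apply/polyOverP => i; rewrite coef_map rpred_int.
have a_rat_neq0 : (a%:~R : rat)^-1 != 0 by rewrite invr_eq0 intr_eq0.
have p_dvd_q : p %| q.
  by rewrite -dvdp_rat_int; move: p0_dvd_q; rewrite Ep dvdpZl.
have [r Eq] := dvdpP_int p_dvd_q.
(* the sign of [zprimitive p] is normalized, which rules out -1 *)
have mon_zp : zprimitive p \is monic.
  have := monicP mon_q; rewrite Eq lead_coefM mulrC => lc1.
  have := sgz_lead_primitive p; rewrite p_neq0.
  rewrite monicE; case/orP: (intUnitRing.unitzPl lc1) => /eqP -> //.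
exists (zprimitive p) => //.
have mon_map : map_poly (intr : int -> K) (zprimitive p) \is monic by exact: monic_map.
apply/eqP; rewrite -eqp_monic ?monic_minPoly //.
rewrite Ep0 -map_poly_int_alg eqp_map Ep.
rewrite [in X in _ %= X](zpolyEprim p) map_polyZ scalerA.
by rewrite eqp_sym eqp_scale // mulf_neq0 // intr_eq0 zcontents_eq0.
Qed.

Lemma sum_powers_horner (K : fieldExtType rat) (R : set K) (n : nat)
    (c : 'I_n -> K) (alpha : K) :
  R 0 -> (forall i, R (c i)) ->
  exists q : {poly K}, [/\ (size q <= n)%N, forall i, R q`_i,
    forall i : 'I_n, q`_i = c i & q.[alpha] = \sum_(i < n) c i * alpha ^+ i].
Proof.
move=> R0 Rc; exists (rVpoly (\row_i c i)); split.
- exact: size_poly.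
- by move=> i; rewrite coef_rVpoly; case: insub => [j|//]; rewrite mxE.
- by move=> i; rewrite coef_rVpoly_ord mxE.
rewrite (horner_coef_wide _ (size_poly _ _)); apply: eq_bigr => i _.
by rewrite coef_rVpoly_ord mxE.
Qed.

Lemma rational_integers_poly (K : fieldExtType rat) (q : {poly K}) :
  (forall i, rational_integers q`_i) <->
  exists s : {poly int}, q = map_poly intr s.
Proof.
split=> [Rq|[s ->] i]; last by rewrite coef_map; exists s`_i.
pose f i := sval (cid2 (Rq i)).
have fE i : (f i)%:~R = q`_i by rewrite /f; case: cid2.
exists (\poly_(i < size q) f i); apply/polyP=> i; rewrite coef_map coef_poly.
by case: ltnP => [_|/leq_sizeP le_i]; rewrite ?fE //= le_i // rmorph0.
Qed.

(** Since the minimal polynomial is monic with integer coefficients, Euclidean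
    division by it stays inside the integer polynomials; the remainder shows
    that the first [\dim {:K}] powers of [alpha] span [Z[alpha]].  An integer
    relation between these powers is a polynomial of degree less than that of
    the minimal polynomial, hence zero. *)
Lemma adjoin_rational_integers_basis (K : fieldExtType rat) (alpha : K) :
  integralOver (intr : int -> K) alpha -> primitive alpha ->
  is_basis (@rational_integers K) (adjoin (@rational_integers K) alpha)
    (fun i : 'I_(\dim {:K}) => alpha ^+ i).
Proof.
move=> int_alpha prim_alpha.
have [p mon_p Ep] := minPoly_int int_alpha.
have size_min : size (minPoly 1 alpha) = (\dim {:K}).+1.
  by rewrite size_minPoly -prim_alpha dim_Fadjoin dimv1 muln1.
have size_p : size p = (\dim {:K}).+1.
  by rewrite -size_min -Ep size_map_poly_id0 // (monicP mon_p) oner_neq0.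
have Z0 : @rational_integers K 0.
  by case: (rational_integers_zmod_closed K) => /set_mem.
split.
  apply/seteqP; split=> [_ [q /rational_integers_poly[s ->] <-]|_ [c Zc <-]].
    have Es := Pdiv.RingMonic.rdivp_eq mon_p s; set r := Pdiv.Ring.rmodp s p in Es.
    have size_r : (size r <= \dim {:K})%N.
      by rewrite -ltnS -size_p Pdiv.Ring.ltn_rmodpN0 // monic_neq0.
    exists (fun i : 'I_(\dim {:K}) => (r`_i)%:~R); first by move=> i; exists r`_i.
    rewrite Es rmorphD rmorphM /= Ep hornerD hornerM minPolyxx mulr0 add0r.
    rewrite (@horner_coef_wide _ (\dim {:K})) ?(leq_trans (size_poly _ _)) //.
    by apply: eq_bigr => i _; rewrite coef_map.
  by have [q [_ Zq _ <-]] := sum_powers_horner alpha Z0 Zc; exists q.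
move=> c Zc; have [q [size_q Zq qE <-]] := sum_powers_horner alpha Z0 Zc => root_q.
have min_dvd_q : minPoly 1 alpha %| q.
  apply: minPoly_dvdp; last exact/rootP.
  by apply/polyOverP => i; case: (Zq i) => n _ <-; rewrite rpred_int.
have q0 : q = 0.
  apply: contraTeq size_q => q_neq0; rewrite -ltnNge -size_min.
  exact: dvdp_leq.
by move=> i; rewrite -qE q0 coef0.
Qed.

Theorem proposition1 (K : fieldExtType rat) (M : {subfield K}) (O : set K)
    (hO : O = ring_of_integers {:K} \/ is_order O)
    (hOM : has_relative_integral_basis O M)
    (alpha : K) (alphaO : O alpha) (alpha_prim : primitive alpha) :
  generates_power_integral_basis O alpha <->
  (relative_index O M alpha = 1%N /\ J M alpha = 1%N).
Proof.
have [Oring int_alpha] : subring_closed (mem O) /\ integralOver (intr : int -> K) alpha.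
  case: hO => [EO|[Oint Oring _]]; last by split=> //; case: (Oint _ alphaO).
  split; last by move: alphaO; rewrite EO => -[].
  by rewrite EO; exact: ring_of_integers_subring_closed.
have O1 : O 1 by case: Oring => /set_mem.
have ZM_zmod := GRing.subring_closedB (ring_of_integers_subring_closed M).
have Z_sub := adjoinS (alpha := alpha) (@rational_integers_sub K M).
have ZM_sub := adjoin_min Oring (ring_of_integers_sub_basis hOM O1) alphaO.
rewrite /relative_index /J.
rewrite (additive_index1P (adjoin_zmod_closed alpha ZM_zmod) ZM_sub).
rewrite (additive_index1P (adjoin_zmod_closed alpha (@rational_integers_zmod_closed K)) Z_sub).
split=> [[EO _]|[EO EZ]]; last first.
  have {}EO : O = adjoin (@rational_integers K) alpha by rewrite EO.
  by split=> //; rewrite EO; exact: adjoin_rational_integers_basis.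
have EZ : adjoin (ring_of_integers M) alpha = adjoin (@rational_integers K) alpha.
  by apply/seteqP; split=> //; rewrite -EO.
by rewrite EZ.
Qed.
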